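(* Let $H$ be the discrete Heisenberg group and let $\phi$ be the automorphism of $H$ given by $$\phi((m,k),s)=\left(\left(s+m,\,-k+\frac{m(m-1)}{2}+sm\right),\,m\right).$$ Then $R(\phi)=2$. The trivial one-dimensional representation is a fixed point of the mapping $\widehat\phi_f$, and the second fixed representation is two-dimensional: it is given by the formula $$\rho((m,k),s)\colon \epsilon_j\mapsto e^{2\pi i\left(m\xi+(k+jm)\eta+\left[\frac{s+j}{p}\right]\alpha\right)}\epsilon_{(j-s)\bmod p},\qquad j=0,\ldots,p-1,$$ with $p=2$, $\alpha=\frac12$, $\xi=\frac14$, $\eta=\frac12$, i.e. $$\rho_2((m,k),s)\colon \epsilon_j\mapsto e^{2\pi i\left(\frac{m}{4}+\frac{k+jm}{2}+\frac12\left[\frac{s+j}{2}\right]\right)}\epsilon_{(j-s)\bmod 2},\qquad j=0,1,$$ where $\epsilon_0,\epsilon_1$ is an orthonormal basis of the two-dimensional space.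
   Context: The discrete Heisenberg group $H=\mathbb{Z}^2\rtimes\mathbb{Z}$ is the set of triplets $((m,k),s)$ of integers with multiplication $((m,k),s)*((m',k'),s')=((m+m',\,k+k'+sm'),\,s+s')$. For an automorphism $\phi$ of a group $G$, elements $x,x'\in G$ are $\phi$-conjugate if there is $g\in G$ with $x'=g\,x\,\phi(g^{-1})$; this is an equivalence relation, and the Reidemeister number $R(\phi)$ is the number of its equivalence classes. $\widehat G_f$ denotes the set of unitary equivalence classes of finite-dimensional irreducible unitary representations of $G$, and $\widehat\phi_f\colon\widehat G_f\to\widehat G_f$ is the mapping $\rho\mapsto\rho\circ\phi$; a fixed representation is a representation whose class is a fixed point of this mapping (here $G=H$). The symbol $[r]$ denotes the integer part of a real number $r$, and $l\bmod p$ denotes the residue of $l$ in $\{0,\ldots,p-1\}$. In the general formula $\epsilon_0,\ldots,\epsilon_{p-1}$ is an orthonormal basis of the $p$-dimensional representation space.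
   Formalization: The displayed operators reverse products under the usual composition of operators, so they are taken to act from the right on row vectors (the first factor applied first); equivalently, the representation is the transpose, sending the (j-s) mod 2 basis vector to the same phase times the j-th. *)

(* Defs.v *)
From HB Require Import structures.
From mathcomp Require Import all_boot all_order all_algebra.
From mathcomp Require Import all_classical all_reals trigo.
From mathcomp Require Import complex spectral zify ring.

Set Implicit Arguments.
Unset Strict Implicit.
Unset Printing Implicit Defensive.

Import Order.TTheory GRing.Theory Num.Theory.

Local Open Scope classical_set_scope.
Local Open Scope ring_scope.

Record automorphism (G : groupType) := Automorphism {
  aut_mor :> {multiplicative G -> G};
  aut_bij : bijective aut_mor
}.

Section Reidemeister.
Variables (G : groupType) (phi : automorphism G).

Definition twisted_conj (x x' : G) : Prop :=
  exists g : G, x' = (g * x * phi g^-1)%g.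

Definition reidemeister_class (x : G) : set G := [set x' | twisted_conj x x'].

(* R(phi) = n is expressed as reidemeister_classes phi #= `I_n. *)
Definition reidemeister_classes : set (set G) := range reidemeister_class.

Lemma aut1 : phi 1%g = 1%g.
Proof. by apply: (mulgI (phi 1%g)); rewrite -gmulfM !mulg1. Qed.

Lemma twisted_conj_refl x : twisted_conj x x.
Proof. by exists 1%g; rewrite invg1 aut1 mul1g mulg1. Qed.

Lemma twisted_conj_sym x y : twisted_conj x y -> twisted_conj y x.
Proof.
move=> [g ->]; exists g^-1%g; rewrite invgK !mulgA mulVg mul1g -mulgA.
by rewrite -gmulfM mulVg aut1 mulg1.
Qed.

Lemma twisted_conj_trans x y z :
  twisted_conj x y -> twisted_conj y z -> twisted_conj x z.
Proof.
by move=> [g ->] [h ->]; exists (h * g)%g; rewrite invgM gmulfM !mulgA.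
Qed.

End Reidemeister.

(* As in the matrix representations of the MathComp library, rho x acts on row
   vectors from the right: row j of rho x is the image of the j-th vector of the
   standard orthonormal basis, and x * y acts as x followed by y. *)
Record unitary_rep (R : realType) (G : groupType) (n : nat) := UnitaryRep {
  rep_mx :> G -> 'M[R[i]]_n;
  rep_mx1 : rep_mx 1%g = 1%:M;
  rep_mxM : {morph rep_mx : x y / (x * y)%g >-> x *m y};
  rep_unitary : forall x, rep_mx x \is unitarymx
}.

Definition irreducible_rep (R : realType) (G : groupType) (n : nat)
    (rho : unitary_rep R G n) : Prop :=
  (0 < n)%N /\
  forall U : 'M[R[i]]_n, (forall x, stablemx U (rho x)) ->
    U = 0 \/ row_full U.

Record unitary_irrep (R : realType) (G : groupType) (n : nat) := UnitaryIrrep {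
  irrep_rep :> unitary_rep R G n;
  irrepP : irreducible_rep irrep_rep
}.

Definition unitary_equiv (R : realType) (G : groupType) (n n' : nat)
    (rho : unitary_rep R G n) (rho' : unitary_rep R G n') : Prop :=
  n = n' /\
  exists2 U : 'M[R[i]]_(n, n'), U \is unitarymx &
    forall x, rho x *m U = U *m rho' x.

Record any_irrep (R : realType) (G : groupType) := AnyIrrep {
  irrep_dim : nat;
  irrep_of :> unitary_irrep R G irrep_dim
}.

Lemma unitary_equiv_refl (R : realType) (G : groupType) n
    (rho : unitary_rep R G n) : unitary_equiv rho rho.
Proof.
split=> //; exists 1%:M; last by move=> x; rewrite mulmx1 mul1mx.
by apply/unitarymxP; rewrite trmx1 map_mx1 mulmx1.
Qed.

Lemma unitary_equiv_sym (R : realType) (G : groupType) n n'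
    (rho : unitary_rep R G n) (rho' : unitary_rep R G n') :
  unitary_equiv rho rho' -> unitary_equiv rho' rho.
Proof.
move=> [en]; case: n' / en rho' => rho' [U Uu UE]; split=> //.
have Uun := unitarymx_unit Uu.
exists (invmx U); first by rewrite invmx_unitary // trmxC_unitary.
by move=> x; rewrite -{1}(mulKmx Uun (rho' x)) -UE mulmxA mulmxK.
Qed.

Lemma unitary_equiv_trans (R : realType) (G : groupType) n1 n2 n3
    (rho1 : unitary_rep R G n1) (rho2 : unitary_rep R G n2)
    (rho3 : unitary_rep R G n3) :
  unitary_equiv rho1 rho2 -> unitary_equiv rho2 rho3 ->
  unitary_equiv rho1 rho3.
Proof.
move=> [en1 [U Uu UE]] [en2 [V Vu VE]]; split; first by rewrite en1.
exists (U *m V); first exact: mul_unitarymx.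
by move=> x; rewrite mulmxA UE -mulmxA VE mulmxA.
Qed.

Section UnitaryDual.
Variables (R : realType) (G : groupType).

Definition irrep_class n (rho : unitary_irrep R G n) :
    set (any_irrep R G) :=
  [set tau : any_irrep R G | unitary_equiv tau rho].

Definition unitary_dual : set (set (any_irrep R G)) :=
  [set c | exists n (rho : unitary_irrep R G n), c = irrep_class rho].

Section Pullback.
Variable phi : automorphism G.

Section PullbackRep.
Variables (n : nat) (rho : unitary_irrep R G n).

Lemma pullback1 : (rho \o phi) 1%g = 1%:M.
Proof. by rewrite /= aut1 rep_mx1. Qed.

Lemma pullbackM : {morph rho \o phi : x y / (x * y)%g >-> x *m y}.
Proof. by move=> x y; rewrite /= gmulfM rep_mxM. Qed.

Lemma pullback_unitary x : (rho \o phi) x \is unitarymx.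
Proof. exact: rep_unitary. Qed.

Definition pullback_rep : unitary_rep R G n :=
  UnitaryRep pullback1 pullbackM pullback_unitary.

Lemma pullback_irreducible : irreducible_rep pullback_rep.
Proof.
case: (irrepP rho) => n0 irr; split=> // U Ust; apply: irr => x.
by have [psi _ phiK] := aut_bij phi; rewrite -[x]phiK; apply: Ust.
Qed.

Definition pullback : unitary_irrep R G n :=
  UnitaryIrrep pullback_irreducible.

End PullbackRep.

(* Sends the class of rho to the class of rho \o phi, cf. dual_map_class. *)
Definition dual_map (c : set (any_irrep R G)) : set (any_irrep R G) :=
  [set tau : any_irrep R G | exists2 rho : any_irrep R G, c rho &
    unitary_equiv tau (pullback rho)].

Lemma dual_map_class n (rho : unitary_irrep R G n) :
  dual_map (irrep_class rho) = irrep_class (pullback rho).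
Proof.
apply/seteqP; split=> [tau [sigma [en [U Uu UE]] tsigma]|tau trho] /=.
- apply: (unitary_equiv_trans tsigma); split=> //; exists U => // x.
  exact: UE.
- exists (AnyIrrep rho) => //; exact: unitary_equiv_refl.
Qed.

Definition dual_fixed : set (set (any_irrep R G)) :=
  [set c | unitary_dual c /\ dual_map c = c].

End Pullback.

Section Trivial.

Let triv_mx (x : G) : 'M[R[i]]_1 := 1%:M.

Lemma triv_mx1 : triv_mx 1%g = 1%:M. Proof. by []. Qed.

Lemma triv_mxM : {morph triv_mx : x y / (x * y)%g >-> x *m y}.
Proof. by move=> x y; rewrite /triv_mx mulmx1. Qed.

Lemma triv_unitary x : triv_mx x \is unitarymx.
Proof. by apply/unitarymxP; rewrite trmx1 map_mx1 mulmx1. Qed.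

Definition trivial_rep : unitary_rep R G 1 :=
  UnitaryRep triv_mx1 triv_mxM triv_unitary.

Lemma trivial_irreducible : irreducible_rep trivial_rep.
Proof.
split=> // U _; have [->|U0] := eqVneq U 0; [by left | right].
by rewrite /row_full eqn_leq rank_leq_col lt0n mxrank_eq0.
Qed.

Definition trivial_irrep : unitary_irrep R G 1 :=
  UnitaryIrrep trivial_irreducible.

End Trivial.

End UnitaryDual.

Definition heisenberg : Type := ((int * int) * int)%type.

HB.instance Definition _ := Choice.on heisenberg.

Definition heis_mul (x y : heisenberg) : heisenberg :=
  let: ((m, k), s) := x in let: ((m', k'), s') := y in
  ((m + m', k + k' + s * m'), s + s').

Definition heis_one : heisenberg := ((0, 0), 0).

Definition heis_inv (x : heisenberg) : heisenberg :=
  let: ((m, k), s) := x in ((- m, - k + s * m), - s).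

Lemma heis_mulA : associative heis_mul.
Proof.
by move=> [[m k] s] [[m' k'] s'] [[n l] t] /=; congr ((_, _), _); ring.
Qed.

Lemma heis_mul1 : left_id heis_one heis_mul.
Proof. by move=> [[m k] s] /=; congr ((_, _), _); ring. Qed.

Lemma heis_1mul : right_id heis_one heis_mul.
Proof. by move=> [[m k] s] /=; congr ((_, _), _); ring. Qed.

Lemma heis_mulV : left_inverse heis_one heis_inv heis_mul.
Proof. by move=> [[m k] s] /=; congr ((_, _), _); ring. Qed.

Lemma heis_Vmul : right_inverse heis_one heis_inv heis_mul.
Proof. by move=> [[m k] s] /=; congr ((_, _), _); ring. Qed.

HB.instance Definition _ := isGroup.Build heisenberg
  heis_mulA heis_mul1 heis_1mul heis_mulV heis_Vmul.

(* The division by 2 is exact. *)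
Definition heis_phi (x : heisenberg) : heisenberg :=
  let: ((m, k), s) := x in
  ((s + m, - k + (m * (m - 1) %/ 2)%Z + s * m), m).

Lemma binz2E (m : int) : (m * (m - 1) %/ 2)%Z * 2 = m * (m - 1).
Proof.
apply: divzK; rewrite (divz_eq m 2).
have : (m %% 2)%Z = 0 \/ (m %% 2)%Z = 1 by lia.
move=> [] ->; [apply: dvdz_mulr|apply: dvdz_mull].
- by rewrite addr0 dvdz_mull.
- by rewrite addrK dvdz_mull.
Qed.

Lemma heis_phiM : {morph heis_phi : x y / (x * y)%g}.
Proof.
move=> [[m k] s] [[m' k'] s']; rewrite /mul /=.
congr ((_, _), _); first by ring.
suff -> : ((m + m') * (m + m' - 1) %/ 2)%Z =
  (m * (m - 1) %/ 2)%Z + (m' * (m' - 1) %/ 2)%Z + m * m' by ring.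
apply: (@mulIf _ (2 : int)) => //.
by rewrite [RHS]mulrDl [in RHS](mulrDl (_ %/ _)%Z) !binz2E; ring.
Qed.

HB.instance Definition _ :=
  isMultiplicative.Build heisenberg heisenberg heis_phi heis_phiM.

Lemma heis_phi_bij : bijective heis_phi.
Proof.
exists (fun x : heisenberg => let: ((m, k), s) := x in
  ((s, - k + (s * (s - 1) %/ 2)%Z + (m - s) * s), m - s)).
- by move=> [[m k] s] /=; congr ((_, _), _); ring.
- by move=> [[m k] s] /=; congr ((_, _), _); ring.
Qed.

Definition heis_aut : automorphism heisenberg :=
  @Automorphism heisenberg heis_phi heis_phi_bij.

Section HeisenbergRep.
Variable R : realType.

(* exp2pii t is e^(2 pi i t). *)
Definition exp2pii (t : R) : R[i] :=
  (cos (2 * pi * t) +i* sin (2 * pi * t))%C.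

Definition eps p (j : 'I_p) : 'rV[R[i]]_p := delta_mx 0 j.

(* epsilon_j |-> e^(2 pi i (m xi + (k + j m) eta + [(s + j) / p] alpha))
   epsilon_((j - s) mod p), with the image of epsilon_j in row j. For p = 2 and
   eta = 1/2 this is multiplicative for the composition order fixed at
   unitary_rep; with matrices acting on the left it would reverse products. *)
Definition heis_rep_mx (p : nat) (alpha xi eta : R) (x : heisenberg) :
    'M[R[i]]_p :=
  let: ((m, k), s) := x in
  \matrix_(j < p, l < p)
    if l%:Z == ((j%:Z - s) %% p%:Z)%Z then
      exp2pii (m%:~R * xi + (k + j%:Z * m)%:~R * eta
               + (Num.floor ((s + j%:Z)%:~R / p%:R : R))%:~R * alpha)
    else 0.

End HeisenbergRep.

(* Main.v *)
Require Import Defs.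
From mathcomp Require Import all_boot all_order all_algebra.
From mathcomp Require Import all_classical all_reals trigo.
From mathcomp Require Import complex spectral zify ring.

(** On the abelianization Z^2 the automorphism acts by a matrix M with
    det (M - 1) = -1, so every element is twisted conjugate to a central one;
    on the centre Z it acts by -1, which leaves exactly two classes.

    Let a, b generate H, with central commutator z. If rho is irreducible and
    equivalent to rho o phi, then rho z, rho (a a), rho (b b) are scalars l, c, d
    by Schur's lemma, and phi preserves these scalars. From phi z = z^-1,
    phi (b b) = a a and phi (a a) = z (a a) (b b) one gets l^2 = 1 and c = d = l.
    If l = 1, then rho is scalar and phi b = a, phi a = a b force it to be trivial.
    If l = -1, then a, b act as anticommuting square roots of -1 (the quaternion
    group); a unit vector v with v a = i v and its image v b span a stable plane
    on which rho is rho2. *)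

Set Implicit Arguments.
Unset Strict Implicit.
Unset Printing Implicit Defensive.

Import Order.TTheory GRing.Theory Num.Theory.

Local Open Scope classical_set_scope.
Local Open Scope card_scope.
Local Open Scope ring_scope.

(** * Twisted conjugacy classes of the automorphism *)

Definition heis (m k s : int) : heisenberg := ((m, k), s).

Lemma heisM m k s m' k' s' :
  (heis m k s * heis m' k' s')%g = heis (m + m') (k + k' + s * m') (s + s').
Proof. by []. Qed.

Lemma heisV m k s : (heis m k s)^-1%g = heis (- m) (- k + s * m) (- s).
Proof. by []. Qed.

Lemma heis_autE m k s :
  heis_aut (heis m k s) = heis (s + m) (- k + (m * (m - 1) %/ 2)%Z + s * m) m.
Proof. by []. Qed.

(** The automorphism inverts central elements, so twisting by a central [g] multiplies a central
    element by [g * g]: only the parity of [k] survives. *)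
Lemma twisted_conj_center (k : int) :
  twisted_conj heis_aut (heis 0 k 0) (heis 0 (k %% 2)%Z 0).
Proof.
exists (heis 0 (- (k %/ 2)%Z) 0).
rewrite heisV heis_autE !heisM; congr heis; lia.
Qed.

Lemma twisted_conj_to_center (x : heisenberg) :
  exists k : int, twisted_conj heis_aut x (heis 0 k 0).
Proof.
case: x => [[m k] s]; rewrite -/(heis m k s).
(* Modulo the centre, twisting by [heis u 0 v] sends the coordinates (m, s) to (m - v, s + v - u);
   both vanish for v = m and u = s + m. *)
pose y := heis (s + m) 0 m.
(* The witness is the central coordinate of the twisted conjugate itself. *)
exists (y * heis m k s * heis_aut y^-1)%g.1.2; exists y.
rewrite /y heisV heis_autE !heisM; congr heis; ring.
Qed.

(** If [g * heis_aut g^-1] is central, then [g] is central, and the product is then [g * g], whose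
    central coordinate is even. *)
Lemma not_twisted_conj_center : ~ twisted_conj heis_aut 1%g (heis 0 1 0).
Proof.
case=> [[[m k] s]]; rewrite mulg1 -/(heis m k s) heisV heis_autE heisM.
move=> [em ek es]; have s0 : s = 0 by lia.
have m0 : m = 0 by lia.
by move: ek; rewrite s0 m0; lia.
Qed.

Lemma reidemeister_class_eq (G : groupType) (phi : automorphism G) (x y : G) :
  twisted_conj phi x y ->
  reidemeister_class phi x = reidemeister_class phi y.
Proof.
move=> xy; apply/seteqP; split=> z /=; apply: twisted_conj_trans => //.
exact: twisted_conj_sym.
Qed.

Lemma reidemeister_classes_heis_aut :
  reidemeister_classes heis_aut =
    [set reidemeister_class heis_aut 1%g;
         reidemeister_class heis_aut (heis 0 1 0)].
Proof.
apply/seteqP; split=> [_ [x _ <-]|_ [|] ->]; last 2 first.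
- by exists 1%g.
- by exists (heis 0 1 0).
have [k /reidemeister_class_eq ->] := twisted_conj_to_center x.
rewrite (reidemeister_class_eq (twisted_conj_center k)).
have : (k %% 2)%Z = 0 \/ (k %% 2)%Z = 1 by lia.
by move=> [|] ->; [left|right].
Qed.

Lemma card_set2 (T : Type) (a b : T) : a <> b -> [set a; b] #= `I_2.
Proof.
move=> ab; apply/eq_cardSP; exists a; first by left.
have -> : [set a; b] `\ a = [set b]; last exact: card_set1.
by apply/seteqP; split=> [x [[//|->]]|_ ->]; split; [right|apply: nesym].
Qed.

Lemma reidemeister_number_heis_aut : reidemeister_classes heis_aut #= `I_2.
Proof.
rewrite reidemeister_classes_heis_aut; apply: card_set2 => E.
apply: not_twisted_conj_center.
suff : reidemeister_class heis_aut 1%g (heis 0 1 0) by [].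
by rewrite E; apply: twisted_conj_refl.
Qed.

(** * The exponential and the monomial matrices of the general formula *)

Lemma exp2piiD (R : realType) (t u : R) :
  exp2pii (t + u) = exp2pii t * exp2pii u.
Proof.
rewrite /exp2pii mulrDr cosD sinD; apply/eqP; rewrite eq_complex /=.
by rewrite eqxx /= addrC.
Qed.

Lemma exp2pii0 (R : realType) : exp2pii (0 : R) = 1.
Proof. by rewrite /exp2pii mulr0 cos0 sin0. Qed.

Lemma exp2pii_quarter (R : realType) : exp2pii (1 / 4 : R) = 'i%C.
Proof.
rewrite /exp2pii (_ : 2 * pi * (1 / 4) = pi / 2) ?cos_pihalf ?sin_pihalf //.
by field.
Qed.

Lemma exp2pii_half (R : realType) : exp2pii (1 / 2 : R) = -1.
Proof.
rewrite /exp2pii (_ : 2 * pi * (1 / 2) = pi) ?cospi ?sinpi; last by field.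
by apply/eqP; rewrite eq_complex /= oppr0 !eqxx.
Qed.

Lemma exp2pii1 (R : realType) : exp2pii (1 : R) = 1.
Proof.
have -> : (1 : R) = 1 / 2 + 1 / 2 by field.
by rewrite exp2piiD exp2pii_half mulrNN mulr1.
Qed.

Lemma exp2pii_int (R : realType) (n : int) : exp2pii (n%:~R : R) = 1.
Proof.
elim/int_rect: n => [|n IH|n IH]; first exact: exp2pii0.
- by rewrite -addn1 PoszD intrD exp2piiD IH exp2pii1 mulr1.
- rewrite -[LHS]mulr1 -(exp2pii1 R) -exp2piiD -addn1 PoszD opprD intrB.
  by rewrite subrK IH exp2pii1.
Qed.

Lemma exp2pii_conj (R : realType) (t : R) : exp2pii t * (exp2pii t)^* = 1.
Proof.
rewrite /exp2pii; set c := cos _; set d := sin _.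
have cd : c ^+ 2 + d ^+ 2 = 1 by rewrite cos2Dsin2.
transitivity ((c ^+ 2 + d ^+ 2) +i* 0)%C; last by rewrite cd.
by congr (_ +i* _)%C; ring.
Qed.

(** Trades the real integer part for Euclidean division, so that phases become integer expressions
    within reach of [lia]. *)
Lemma floor_int_div2 (R : realType) (n : int) :
  Num.floor (n%:~R / 2 : R) = (n %/ 2)%Z.
Proof.
apply: floor_def; rewrite ler_pdivlMr // ltr_pdivrMr //.
by rewrite -!(intrM R _ 2) ler_int ltr_int; lia.
Qed.

Lemma eps_heis_rep (R : realType) (p : nat) (alpha xi eta : R) (m k s : int)
    (j l : 'I_p) : l%:Z = ((j%:Z - s) %% p%:Z)%Z ->
  eps R j *m heis_rep_mx p alpha xi eta ((m, k), s) =
  exp2pii (m%:~R * xi + (k + j%:Z * m)%:~R * eta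
           + (Num.floor ((s + j%:Z)%:~R / p%:R : R))%:~R * alpha) *: eps R l.
Proof.
move=> lE; apply/rowP=> i; rewrite -rowE !mxE eqxx /= -lE eqz_nat.
by rewrite (inj_eq val_inj); case: eqP => _; rewrite ?mulr1 ?mulr0.
Qed.

(** The index [j] excludes p = 0, so the integer residue is an ordinal. *)
Lemma eps_shift (p : nat) (j : 'I_p) (s : int) :
  exists l : 'I_p, l%:Z = ((j%:Z - s) %% p%:Z)%Z.
Proof.
case: p j => [[]//|p] j.
have lt : (absz ((j%:Z - s) %% p.+1%:Z)%Z < p.+1)%N by lia.
by exists (Ordinal lt) => /=; lia.
Qed.

(** The matrix is monomial with entries of modulus one, and j - s mod p determines [j], so distinct
    rows have disjoint supports. *)
Lemma heis_rep_unitary (R : realType) (p : nat) (alpha xi eta : R) x :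
  heis_rep_mx p alpha xi eta x \is unitarymx.
Proof.
case: x => [[m k] s]; apply/row_unitarymxP => i j.
have [a aE] := eps_shift i s; have [b bE] := eps_shift j s.
rewrite !rowE !(eps_heis_rep _ _ _ _ _ aE).
rewrite !(eps_heis_rep _ _ _ _ _ bE).
rewrite dotmxE mxE (bigD1 a) //= !mxE !eqxx /=.
rewrite big1 ?addr0 => [|l la]; last first.
  by rewrite !mxE (negbTE la) !mulr0 mul0r.
rewrite mulr1; have [ij|] := eqVneq i j.
  have -> : a = b by apply/val_inj/eqP; rewrite -eqz_nat aE bE ij.
  by rewrite eqxx mulr1 ij exp2pii_conj.
have [ab /eqP[]|_ _] := eqVneq a b; last by rewrite mulr0 conjC0 mulr0.
have : (i%:Z == j%:Z %[mod p%:Z])%Z.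
  by rewrite -(subrK s i%:Z) -(subrK s j%:Z) -modzDml -aE ab bE modzDml.
by rewrite !modz_small ?ltz_nat ?ltn_ord // eqz_nat => /eqP/val_inj.
Qed.

(** * The two-dimensional representation *)

Section Rho2.
Variable R : realType.

Definition rho2_mx : heisenberg -> 'M[R[i]]_2 :=
  heis_rep_mx 2 (1 / 2) (1 / 4) (1 / 2).

(** For these parameters every phase is an integer over 4, so comparing matrix entries becomes a
    congruence modulo 4. *)
Lemma eps_rho2 (m k s : int) (j l : 'I_2) : l%:Z = ((j%:Z - s) %% 2)%Z ->
  eps R j *m rho2_mx ((m, k), s) =
  exp2pii ((m + 2 * (k + j%:Z * m) + 2 * ((s + j%:Z) %/ 2)%Z)%:~R / 4)
  *: eps R l.
Proof.
move=> lE; rewrite /rho2_mx (eps_heis_rep _ _ _ _ _ lE).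
rewrite floor_int_div2; congr (exp2pii _ *: _).
by rewrite !intrD !intrM; field.
Qed.

Lemma eq_exp2pii_quarter (a b : int) : (a = b %[mod 4])%Z ->
  exp2pii (a%:~R / 4 : R) = exp2pii (b%:~R / 4).
Proof.
move=> ab; rewrite (divz_eq a 4) (divz_eq b 4) ab.
rewrite !intrD !mulrDl !exp2piiD !intrM !mulfK ?exp2pii_int //.
all: by rewrite intr_eq0.
Qed.

Lemma rho2_1 : rho2_mx 1%g = 1%:M.
Proof.
apply/row_matrixP => j; rewrite !rowE mulmx1.
have jE : j%:Z = ((j%:Z - 0) %% 2)%Z by move: (ltn_ord j); lia.
rewrite (eps_rho2 _ _ jE) (_ : _ / 4 = 0) ?exp2pii0 ?scale1r //.
rewrite (_ : _ + _ = 0 :> int) ?mul0r //; move: (ltn_ord j); lia.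
Qed.

Lemma rho2_M : {morph rho2_mx : x y / (x * y)%g >-> x *m y}.
Proof.
move=> [[m k] s] [[m' k'] s'].
apply/row_matrixP => j; rewrite !rowE mulmxA.
have [l lE] := eps_shift j s; have [l' lE'] := eps_shift l s'.
have lE'' : l'%:Z = ((j%:Z - (s + s')) %% 2)%Z by lia.
rewrite (eps_rho2 _ _ lE) -scalemxAl (eps_rho2 _ _ lE') scalerA.
rewrite (eps_rho2 _ _ lE'') -exp2piiD -mulrDl -intrD; congr (_ *: _).
(* Signs do not matter modulo 2, so s + j = 2q + l for some q. Hence the integer parts add up
   exactly, and 2(s + j)m' agrees with 2lm' modulo 4. *)
apply: eq_exp2pii_quarter; move: (ltn_ord j) (ltn_ord l).
case: j l {l' lE' lE''} lE => [[|[|//]] ?] [[|[|//]] ?] /=; lia.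
Qed.

Lemma rho2_unitary x : rho2_mx x \is unitarymx.
Proof. exact: heis_rep_unitary. Qed.

Definition rho2_rep : unitary_rep R heisenberg 2 :=
  UnitaryRep rho2_1 rho2_M rho2_unitary.

End Rho2.

(** * Generators of the Heisenberg group *)

Definition heis_a : heisenberg := heis 1 0 0.
Definition heis_b : heisenberg := heis 0 0 1.
Definition heis_z : heisenberg := heis 0 1 0.

(** Every element has the normal form z^k a^m b^s, and z is the commutator of b and a. *)
Lemma heis_gen_ind (P : heisenberg -> Prop) :
  P heis_a -> P heis_b -> (forall x y, P x -> P y -> P (x * y)%g) ->
  (forall x, P x -> P x^-1%g) -> forall x, P x.
Proof.
move=> Pa Pb PM PV.
have P1 : P 1%g by rewrite -(mulgV heis_a); apply: PM => //; apply: PV.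
have Pz : P heis_z.
  have -> : heis_z = (heis_b * heis_a * (heis_a * heis_b)^-1)%g by [].
  by apply: (PM); [|apply: PV]; apply: PM.
(* A homomorphism [f] from the integers takes values in [P] once [f 1] does; this is applied to the
   powers of z, a and b. *)
have PX (f : int -> heisenberg) : f 0 = 1%g -> P (f 1) ->
    (forall i j, f (i + j) = (f i * f j)%g) -> forall i, P (f i).
  move=> f0 Pf1 fD; elim/int_rect => [|i IH|i IH]; first by rewrite f0.
  - by rewrite -addn1 PoszD fD; apply: PM.
  - rewrite -addn1 PoszD opprD fD; apply: PM => //.
    suff -> : f (-1) = (f 1%R)^-1%g by apply: PV.
    by apply: (mulgI (f 1)); rewrite -fD f0 mulgV.
case=> -[m k] s.
have -> : ((m, k), s) = (heis 0 k 0 * (heis m 0 0 * heis 0 0 s))%g.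
  by rewrite !heisM /heis; congr ((_, _), _); ring.
apply: (PM); last apply: (PM).
- apply: (PX (fun k => heis 0 k 0)) => // i j.
  by rewrite heisM; congr heis; ring.
- apply: (PX (fun m => heis m 0 0)) => // i j.
  by rewrite heisM; congr heis; ring.
- apply: (PX (fun s => heis 0 0 s)) => // i j.
  by rewrite heisM; congr heis; ring.
Qed.

Lemma scalar_mx_eq (F : fieldType) (n : nat) (c d : F) : (0 < n)%N ->
  c%:M = d%:M :> 'M_n -> c = d.
Proof.
by case: n => // n _ /matrixP /(_ 0 0); rewrite !mxE eqxx.
Qed.

(** * Schur's lemma and intertwiners *)

Section UnitaryRep.
Variables (R : realType) (G : groupType) (n : nat).

Lemma rep_mx_unit (rho : unitary_rep R G n) x : rho x \in unitmx.
Proof. exact/unitarymx_unit/rep_unitary. Qed.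

Lemma rep_mxV (rho : unitary_rep R G n) x : rho x^-1%g = invmx (rho x).
Proof.
apply: (can_inj (mulKmx (rep_mx_unit rho x))).
by rewrite -rep_mxM mulgV rep_mx1 mulmxV ?rep_mx_unit.
Qed.

(** Conjugation leaves scalars unchanged. This is how a fixed class is exploited: [rho] takes the
    same value at x and at its image under the automorphism whenever [rho x] is scalar. *)
Lemma unitary_equiv_scalar n' (rho : unitary_rep R G n)
    (rho' : unitary_rep R G n') x c :
  unitary_equiv rho rho' -> rho x = c%:M -> rho' x = c%:M.
Proof.
move=> [en]; case: n' / en rho' => rho' [U Uu UE] rx.
apply: (can_inj (mulKmx (unitarymx_unit Uu))).
by rewrite -UE rx scalar_mxC.
Qed.

(** Over an algebraically closed field [A] has an eigenvalue; its eigenspace is stable and nonzero,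
    hence full. *)
Lemma schur (rho : unitary_rep R G n) (A : 'M[R[i]]_n) : irreducible_rep rho ->
  (forall x, A *m rho x = rho x *m A) -> exists c, A = c%:M.
Proof.
move=> [n0 irr] Arho; have [c /eigenvalueP [v vA v0]] := eigenvalue_closed A n0.
exists c; case: (irr (eigenspace A c)) => [x|E0|Efull].
- exact: comm_mx_stable_eigenspace.
- have : (v <= eigenspace A c)%MS by apply/eigenspaceP.
  by rewrite E0 submx0 (negbTE v0).
- have : (1%:M <= eigenspace A c)%MS by rewrite submx_full.
  by move/eigenspaceP; rewrite mul1mx scalemx1.
Qed.

(* The row space of W is stable under rho, so that irreducibility forces the
   dimensions to agree. *)
Lemma unitary_equiv_intertwiner m (rho' : unitary_rep R G m)
    (rho : unitary_rep R G n) (W : 'M[R[i]]_(m, n)) :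
  (0 < m)%N -> irreducible_rep rho -> W \is unitarymx ->
  (forall x, W *m rho x = rho' x *m W) -> unitary_equiv rho' rho.
Proof.
move=> m0 [n0 irr] Wu WE; have rkW := mxrank_unitary Wu.
split; last by exists W.
case: (irr <<W>>%MS) => [x|W0|Wfull].
- by rewrite (eqmxMr _ (genmxE W)) genmxE WE submxMl.
- by move: m0; rewrite -rkW -(genmxE W) W0 mxrank0.
- by move: Wfull; rewrite /row_full genmxE rkW => /eqP.
Qed.

End UnitaryRep.

Lemma heis_intertwiner (R : realType) m n (rho' : unitary_rep R heisenberg m)
    (rho : unitary_rep R heisenberg n) (W : 'M[R[i]]_(m, n)) :
  W *m rho heis_a = rho' heis_a *m W -> W *m rho heis_b = rho' heis_b *m W ->
  forall x, W *m rho x = rho' x *m W.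
Proof.
move=> Wa Wb; apply: heis_gen_ind => // [x y Wx Wy|x Wx].
- by rewrite !rep_mxM mulmxA Wx -mulmxA Wy mulmxA.
- rewrite !rep_mxV; apply: (can_inj (mulKmx (rep_mx_unit rho' x))).
  by rewrite mulmxA -Wx mulmxK ?rep_mx_unit // mulKVmx ?rep_mx_unit.
Qed.

Lemma heis_schur (R : realType) n (rho : unitary_rep R heisenberg n)
    (A : 'M[R[i]]_n) : irreducible_rep rho ->
  A *m rho heis_a = rho heis_a *m A -> A *m rho heis_b = rho heis_b *m A ->
  exists c, A = c%:M.
Proof.
by move=> irr Aa Ab; apply: (schur irr) => x; apply: heis_intertwiner.
Qed.

Lemma rep_scalar_inj (R : realType) (G : groupType) n
    (rho : unitary_rep R G n) x c d : irreducible_rep rho ->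
  rho x = c%:M -> rho x = d%:M -> c = d.
Proof. by move=> [n0 _] -> /(scalar_mx_eq n0). Qed.

(* Every unit vector intertwines the trivial representation with rho. *)
Lemma unitary_equiv_trivial (R : realType) n (rho : unitary_rep R heisenberg n) :
  irreducible_rep rho -> rho heis_a = 1%:M -> rho heis_b = 1%:M ->
  unitary_equiv (trivial_rep R heisenberg) rho.
Proof.
move=> irr ra rb; have n0 := irr.1.
pose v : 'rV[R[i]]_n := delta_mx 0 (Ordinal n0).
apply: (unitary_equiv_intertwiner (W := v)) => //.
- apply/unitarymxP; rewrite trmx_delta map_delta_mx mul_delta_mx.
  by apply/matrixP=> i j; rewrite !mxE !ord1.
- by apply: heis_intertwiner; rewrite /= mul1mx ?ra ?rb mulmx1.
Qed.

(** * Action of the generators under rho2, and irreducibility *)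

Section Rho2Generators.
Variable R : realType.

Lemma eps_rho2_a (j : 'I_2) :
  eps R j *m rho2_rep R heis_a = ((-1) ^+ j * 'i%C) *: eps R j.
Proof.
have jE : j%:Z = ((j%:Z - 0) %% 2)%Z by move: (ltn_ord j); lia.
rewrite [LHS](eps_rho2 _ _ _ jE) -exp2pii_quarter -exp2pii_half.
case: j {jE} => [[|[|//]] ?] /=; first by rewrite expr0 mul1r.
rewrite expr1 -exp2piiD; congr (exp2pii _ *: _).
by rewrite [X in X%:~R](_ : _ = 3) //; field.
Qed.

Lemma eps_rho2_b0 : eps R 0 *m rho2_rep R heis_b = eps R (1 : 'I_2).
Proof.
by rewrite [LHS](@eps_rho2 _ _ _ _ _ 1) //= mul0r exp2pii0 scale1r.
Qed.

(** The sign is the carry: [(1 + 1) / 2] = 1 contributes the phase 1/2. *)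
Lemma eps_rho2_b1 : eps R (1 : 'I_2) *m rho2_rep R heis_b = - eps R 0.
Proof.
rewrite [LHS](@eps_rho2 _ _ _ _ _ 0) //= -scaleN1r -exp2pii_half.
congr (exp2pii _ *: _).
by rewrite [X in X%:~R](_ : _ = 2) //; field.
Qed.

(** The image of a is diagonal with distinct eigenvalues i and -i, so a stable subspace contains
    both components of each of its vectors; b exchanges the two eigenlines. *)
Lemma rho2_irreducible : irreducible_rep (rho2_rep R).
Proof.
split=> // U Ust; have [->|/rowV0Pn [v vU v0]] := eqVneq U 0; [by left|right].
have Umul x u : (u <= U)%MS -> (u *m rho2_rep R x <= U)%MS.
  by move=> uU; apply: submx_trans (Ust x); apply: submxMr.
set x := v 0 0; set y := v 0 1.
have vE : v = x *: eps R 0 + y *: eps R 1.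
  apply/rowP => -[[|[|//]] lt]; rewrite !mxE /= ?(mulr1, mulr0, addr0, add0r).
  - by congr (v _ _); apply: val_inj.
  - by congr (v _ _); apply: val_inj.
have vaE : v *m rho2_rep R heis_a =
    (x * 'i%C) *: eps R 0 - (y * 'i%C) *: eps R 1.
  rewrite {1}vE mulmxDl -!scalemxAl !eps_rho2_a !scalerA expr0 expr1 mul1r.
  by rewrite mulN1r mulrN scaleNr.
have ii : 'i%C * 'i%C = -1 :> R[i] by rewrite -expr2 sqr_i.
have nz2 : (2 : R[i]) != 0 by rewrite pnatr_eq0.
have e01 : (eps R 0 <= U)%MS -> (eps R (1 : 'I_2) <= U)%MS.
  by rewrite -eps_rho2_b0; apply: Umul.
have e10 : (eps R (1 : 'I_2) <= U)%MS -> (eps R 0 <= U)%MS.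
  by move/(Umul _ heis_b); rewrite eps_rho2_b1 eqmx_opp.
have xU : (x *: eps R 0 <= U)%MS.
  (* The projection onto the eigenline of i is (1 - iA)/2, with A the image of a. *)
  rewrite (_ : _ *: _ = 2^-1 *: (v + - 'i%C *: (v *m rho2_rep R heis_a))).
    by rewrite scalemx_sub // addmx_sub // scalemx_sub // Umul.
  have iK (c : R[i]) : - 'i%C * (c * 'i%C) = c.
    by rewrite mulrC -mulrA mulrN ii opprK mulr1.
  rewrite vaE {1}vE scalerBr !scalerA !iK addrACA subrr addr0 -scalerDl scalerA.
  by rewrite -mulr2n -[x *+ 2]mulr_natl mulKf.
have yU : (y *: eps R (1 : 'I_2) <= U)%MS.
  rewrite (_ : _ *: _ = v - x *: eps R 0); last by rewrite vE addrC addKr.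
  by rewrite addmx_sub ?eqmx_opp.
have [e0 e1] : (eps R 0 <= U)%MS /\ (eps R (1 : 'I_2) <= U)%MS.
  have [x0|x0] := eqVneq x 0; last first.
    have e0 : (eps R 0 <= U)%MS by rewrite -(eqmx_scale _ x0).
    by split=> //; apply: e01.
  have y0 : y != 0.
    by apply: contra_neq v0 => y0; rewrite vE x0 y0 !scale0r addr0.
  have e1 : (eps R (1 : 'I_2) <= U)%MS by rewrite -(eqmx_scale _ y0).
  by split=> //; apply: e10.
rewrite -sub1mx; apply/row_subP => -[[|[|//]] lt]; rewrite row1.
- by rewrite (_ : Ordinal _ = 0) //; apply: val_inj.
- by rewrite (_ : Ordinal _ = 1) //; apply: val_inj.
Qed.

(** An even [s] makes the matrix diagonal, and the numerator 2 over 4 gives the phase 1/2 in each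
    row. *)
Lemma rho2_minus1 (m k s : int) : (s %% 2)%Z = 0 ->
  (forall j : 'I_2,
     m + 2 * (k + j%:Z * m) + 2 * ((s + j%:Z) %/ 2)%Z = 2 %[mod 4])%Z ->
  rho2_rep R (heis m k s) = (-1)%:M.
Proof.
move=> s2 N2; apply/row_matrixP => j; rewrite !rowE.
have jE : j%:Z = ((j%:Z - s) %% 2)%Z by move: (ltn_ord j); lia.
rewrite [LHS](eps_rho2 _ _ _ jE) (eq_exp2pii_quarter _ (N2 j)).
rewrite (_ : _ / 4 = 1 / 2) ?exp2pii_half ?mul_mx_scalar //.
by field.
Qed.

End Rho2Generators.

(** * Recognizing rho2 from three scalars *)

Lemma dotmxZ (C : numClosedFieldType) n (c d : C) (u w : 'rV[C]_n) :
  dotmx (c *: u) (d *: w) = c * d^* * dotmx u w.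
Proof.
rewrite !dotmxE linearZ map_mxZ -scalemxAl -scalemxAr scalerA.
by rewrite mxE.
Qed.

Lemma dotmx_unitary (C : numClosedFieldType) n (A : 'M[C]_n) (u w : 'rV[C]_n) :
  A \is unitarymx -> dotmx (u *m A) (w *m A) = dotmx u w.
Proof.
by move=> Au; rewrite !dotmxE trmx_mul map_mxM mulmxA mulmxtVK.
Qed.

(** A unitary matrix is normal, so the spectral theorem diagonalizes it by a unitary matrix, whose
    rows are unit eigenvectors. *)
Lemma unitary_unit_eigenvector (C : numClosedFieldType) n (A : 'M[C]_n) :
  (0 < n)%N -> A \is unitarymx ->
  exists (c : C) (v : 'rV[C]_n), v *m A = c *: v /\ dotmx v v = 1.
Proof.
move=> n0 Au; have An : A \is normalmx.
  apply/normalmxP; rewrite (unitarymxP Au) -invmx_unitary //.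
  by rewrite mulVmx ?unitarymx_unit.
have Pu := spectral_unitarymx A; set P := spectralmx A in Pu.
have AE := orthomx_spectralP An.
exists (spectral_diag A 0 (Ordinal n0)), (row (Ordinal n0) P); split; last first.
  by rewrite (row_unitarymxP Pu) eqxx.
rewrite {1}AE -row_mul !mulmxA mulmxV ?unitarymx_unit // mul1mx.
by rewrite mul_diag_mx; apply/rowP=> j; rewrite !mxE.
Qed.

(** Phrased through the values at z, aa and bb alone, so that it serves both to classify fixed
    representations and to show that rho2 is fixed. *)
Lemma unitary_equiv_rho2 (R : realType) n (rho : unitary_rep R heisenberg n) :
  irreducible_rep rho -> rho heis_z = (-1)%:M ->
  rho (heis_a * heis_a)%g = (-1)%:M -> rho (heis_b * heis_b)%g = (-1)%:M ->
  unitary_equiv (rho2_rep R) rho.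
Proof.
move=> irr rz raa rbb; have n0 := irr.1.
have Au := rep_unitary rho heis_a; have Bu := rep_unitary rho heis_b.
move: raa rbb; rewrite !rep_mxM.
have : rho heis_b *m rho heis_a = - (rho heis_a *m rho heis_b).
  rewrite -[LHS]rep_mxM.
  rewrite (_ : (heis_b * heis_a)%g = (heis_z * (heis_a * heis_b))%g) //.
  by rewrite !rep_mxM rz mul_scalar_mx scaleN1r.
set A := rho heis_a in Au *; set B := rho heis_b in Bu *.
move=> BA AA BB.
have [v [vA v1]] : exists v : 'rV_n, v *m A = 'i%C *: v /\ dotmx v v = 1.
  have [c [v [vA v1]]] := unitary_unit_eigenvector n0 Au.
  have v0 : v != 0.
    apply/eqP => v0; move: v1; rewrite v0 linear0l => /esym/eqP.
    by rewrite oner_eq0.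
  have : (c ^+ 2 + 1) *: v == 0.
    rewrite scalerDl scale1r expr2 -scalerA -vA scalemxAl -vA -mulmxA AA.
    by rewrite mul_mx_scalar scaleN1r addNr.
  rewrite scaler_eq0 (negbTE v0) orbF addr_eq0 -(sqr_i R).
  rewrite eqf_sqr => /orP[] /eqP cE; first by exists v; rewrite vA cE.
  (* Here c = -i; since [B] anticommutes with [A], it carries [v] to an eigenvector for i. *)
  exists (v *m B); rewrite dotmx_unitary //; split=> //.
  by rewrite -mulmxA BA mulmxN mulmxA vA cE scaleNr mulNmx opprK -scalemxAl.
have vBA : v *m B *m A = - 'i%C *: (v *m B).
  by rewrite -mulmxA BA mulmxN mulmxA vA -scalemxAl scaleNr.
have iiC : 'i%C * 'i%C^* = 1 :> R[i] by rewrite -exp2pii_quarter exp2pii_conj.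
(* Eigenvectors of a unitary matrix for i and -i are orthogonal: applying [A] to both arguments
   preserves the product, yet changes its sign. *)
have vB0 : dotmx v (v *m B) = 0.
  apply/eqP; rewrite -eqNr -{2}(dotmx_unitary _ _ Au) vA vBA dotmxZ.
  by rewrite rmorphN mulrN iiC mulN1r.
have Bv0 : dotmx (v *m B) v = 0.
  apply/eqP; rewrite -eqNr -{2}(dotmx_unitary _ _ Au) vA vBA dotmxZ.
  by rewrite mulNr iiC mulN1r.
pose W : 'M[R[i]]_(2, n) := \matrix_(j < 2) (if j == 0 then v else v *m B).
have W0 : eps R 0 *m W = v by rewrite -rowE rowK.
have W1 : eps R (1 : 'I_2) *m W = v *m B by rewrite -rowE rowK.
apply: (unitary_equiv_intertwiner (W := W)) => //.
- apply/row_unitarymxP => i j; rewrite !rowK.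
  by case: i j => [[|[|//]] ?] [[|[|//]] ?] //=; rewrite dotmx_unitary.
- apply: heis_intertwiner; apply/row_matrixP => j; rewrite !rowE -/(eps R j);
    have [->|->] : j = 0 \/ j = 1 by
      case: j => [[|[|//]] ?]; [left|right]; apply: val_inj.
  + by rewrite !mulmxA W0 eps_rho2_a -scalemxAl W0 vA expr0 mul1r.
  + by rewrite !mulmxA W1 eps_rho2_a -scalemxAl W1 vBA expr1 mulN1r.
  + by rewrite !mulmxA W0 eps_rho2_b0 W1.
  + rewrite !mulmxA W1 eps_rho2_b1 mulNmx W0 -mulmxA BB.
    by rewrite mul_mx_scalar scaleN1r.
Qed.

(** * Classification of the fixed irreducible representations *)

Lemma rep_scalarM (R : realType) (G : groupType) n (rho : unitary_rep R G n)
    x y c d :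
  rho x = c%:M -> rho y = d%:M -> rho (x * y)%g = (c * d)%:M.
Proof. by move=> rx ry; rewrite rep_mxM rx ry scalar_mxM. Qed.

Lemma rep_scalar_neq0 (R : realType) (G : groupType) n
    (rho : unitary_rep R G n) x c : (0 < n)%N -> rho x = c%:M -> c != 0.
Proof.
move=> n0 rx; apply/eqP => c0; have := rep_mx_unit rho x.
by rewrite -row_free_unit rx c0 raddf0 /row_free mxrank0 ltn_eqF.
Qed.

Lemma heis_dual_fixed_cases (R : realType) n (rho : unitary_irrep R heisenberg n) :
  unitary_equiv (pullback heis_aut rho) rho ->
  unitary_equiv (trivial_rep R heisenberg) rho \/ unitary_equiv (rho2_rep R) rho.
Proof.
move=> fixed; have irr := irrepP rho.
have aut_scalar x c : rho x = c%:M -> rho (heis_aut x) = c%:M.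
  exact: (unitary_equiv_scalar (unitary_equiv_sym fixed)).
have comm_scalar x : rho (x * heis_a)%g = rho (heis_a * x)%g ->
    rho (x * heis_b)%g = rho (heis_b * x)%g -> exists c, rho x = c%:M.
  by move=> xa xb; apply: (heis_schur irr); rewrite -!rep_mxM.
have [l rz] : exists l, rho heis_z = l%:M by apply: comm_scalar.
have ll : l * l = 1.
  (* The product [heis_z * heis_aut heis_z] computes to 1. *)
  apply: (rep_scalar_inj irr (rep_scalarM rz (aut_scalar _ _ rz))).
  exact: rep_mx1.
(* Moving b past aa, or a past bb, costs z^2, which acts as l^2 = 1; so both squares commute with
   the generators under [rho]. *)
have [c raa] : exists c, rho (heis_a * heis_a)%g = c%:M.
  apply: comm_scalar => //.
  have -> : (heis_b * (heis_a * heis_a) =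
    heis_z * heis_z * (heis_a * heis_a * heis_b))%g by [].
  by rewrite [RHS]rep_mxM (rep_scalarM rz rz) ll mul1mx.
have [d rbb] : exists d, rho (heis_b * heis_b)%g = d%:M.
  apply: comm_scalar => //.
  have -> : (heis_b * heis_b * heis_a =
    heis_z * heis_z * (heis_a * (heis_b * heis_b)))%g by [].
  by rewrite [LHS]rep_mxM (rep_scalarM rz rz) ll mul1mx.
have cd : c = d by apply: (rep_scalar_inj irr raa); apply: aut_scalar rbb.
have c0 := rep_scalar_neq0 irr.1 raa.
have cl : c = l.
  (* Evaluating at the image z(aa)(bb) of aa gives c = l c d = l c^2. Cancelling c leaves l c = 1,
     and l^2 = 1 then yields c = l. *)
  have := rep_scalar_inj irr (aut_scalar _ _ raa)
    (rep_scalarM rz (rep_scalarM raa rbb)).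
  rewrite -cd -[c in c = _ -> _]mul1r mulrA => /(mulIf c0) lc.
  by rewrite -[RHS]mulr1 lc mulrA ll mul1r.
move: ll => /eqP; rewrite -expr2 sqrf_eq1 => /orP[] /eqP lE; last first.
  by right; apply: (unitary_equiv_rho2 irr); rewrite ?rz ?raa ?rbb -?cd ?cl lE.
left.
have ba : rho (heis_b * heis_a)%g = rho (heis_a * heis_b)%g.
  rewrite (_ : (heis_b * heis_a)%g = (heis_z * (heis_a * heis_b))%g) //.
  by rewrite [LHS]rep_mxM rz lE mul1mx.
have [x ra] : exists x, rho heis_a = x%:M by apply: comm_scalar.
have [y rb] : exists y, rho heis_b = y%:M.
  by apply: (heis_schur irr); rewrite -?rep_mxM.
(* The image of b is a, so x = y; the image of a is ab, so x = x y. Hence x^2 = x with x nonzero. *)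
have xy : x = y by apply: (rep_scalar_inj irr ra); apply: aut_scalar rb.
have x_xy : x = x * y.
  exact: (rep_scalar_inj irr (aut_scalar _ _ ra) (rep_scalarM ra rb)).
have x1 : x = 1.
  by apply: (mulfI (rep_scalar_neq0 irr.1 ra)); rewrite mulr1 {2}xy.
by apply: (unitary_equiv_trivial irr); rewrite ?ra ?rb -?xy x1.
Qed.

(** * Fixed points in the unitary dual *)

Lemma irrep_class_eq (R : realType) (G : groupType) n n'
    (rho : unitary_irrep R G n) (rho' : unitary_irrep R G n') :
  irrep_class rho = irrep_class rho' <-> unitary_equiv rho rho'.
Proof.
split=> [E|e].
- have : irrep_class rho (AnyIrrep rho) by apply: unitary_equiv_refl.
  by rewrite E.
- apply/seteqP; split=> tau te; apply: unitary_equiv_trans te _ => //.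
  exact: unitary_equiv_sym.
Qed.

Definition rho2_irrep (R : realType) : unitary_irrep R heisenberg 2 :=
  UnitaryIrrep (rho2_irreducible R).

Lemma dual_fixed_class (R : realType) (G : groupType) (phi : automorphism G) n
    (rho : unitary_irrep R G n) :
  unitary_equiv (pullback phi rho) rho -> dual_fixed phi (irrep_class rho).
Proof.
move=> fixed; split; first by exists n, rho.
by rewrite dual_map_class; apply/irrep_class_eq.
Qed.

Lemma trivial_dual_fixed (R : realType) (G : groupType) (phi : automorphism G) :
  dual_fixed phi (irrep_class (trivial_irrep R G)).
Proof.
apply: dual_fixed_class; split=> //; exists 1%:M => [|x].
  exact: (triv_unitary R (1%g : G)).
by rewrite /= mulmx1.
Qed.

(** Instead of an explicit intertwiner, the three scalars of the pullback are computed and rho2 is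
    recognized from them. *)
Lemma rho2_dual_fixed (R : realType) :
  dual_fixed heis_aut (irrep_class (rho2_irrep R)).
Proof.
apply: dual_fixed_class; apply: unitary_equiv_sym.
apply: unitary_equiv_rho2; first exact: irrepP.
(* The triples here and below are the images of z, aa and bb under the automorphism. *)
- by apply: (@rho2_minus1 R 0 (-1) 0) => // j; move: (ltn_ord j); lia.
- by apply: (@rho2_minus1 R 2 1 2) => // j; move: (ltn_ord j); lia.
- by apply: (@rho2_minus1 R 2 0 0) => // j; move: (ltn_ord j); lia.
Qed.

Lemma heis_dual_fixedE (R : realType) :
  dual_fixed heis_aut = [set irrep_class (trivial_irrep R heisenberg);
                             irrep_class (rho2_irrep R)].
Proof.
apply/seteqP; split=> [_ [[n [rho ->]]]|_ [|] ->]; last 2 first.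
- exact: trivial_dual_fixed.
- exact: rho2_dual_fixed.
rewrite dual_map_class => /irrep_class_eq /heis_dual_fixed_cases [] e.
- by left; apply/irrep_class_eq/unitary_equiv_sym.
- by right; apply/irrep_class_eq/unitary_equiv_sym.
Qed.

Theorem mainTheorem4 (R : realType) :
  reidemeister_classes heis_aut #= `I_2 /\
  dual_fixed heis_aut (irrep_class (trivial_irrep R heisenberg)) /\
  exists rho2 : unitary_irrep R heisenberg 2,
    [/\ (forall x : heisenberg,
           rho2 x = heis_rep_mx 2 (1 / 2 : R) (1 / 4) (1 / 2) x),
        (forall (m k s : int) (j l : 'I_2), l%:Z = ((j%:Z - s) %% 2)%Z ->
           eps R j *m rho2 ((m, k), s) =
           exp2pii (m%:~R / 4 + (k + j%:Z * m)%:~R / 2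
             + 1 / 2 * (Num.floor ((s + j%:Z)%:~R / 2 : R))%:~R) *: eps R l),
        irrep_class rho2 <> irrep_class (trivial_irrep R heisenberg) &
        dual_fixed heis_aut =
          [set irrep_class (trivial_irrep R heisenberg); irrep_class rho2]].
Proof.
split; first exact: reidemeister_number_heis_aut.
split; first exact: trivial_dual_fixed.
exists (rho2_irrep R); split=> // [m k s j l lE||].
- rewrite [LHS](eps_heis_rep _ _ _ _ _ lE); congr (exp2pii _ *: _).
  by field.
(* Equivalence would force the dimensions 2 and 1 to agree. *)
- by move/irrep_class_eq => -[].
- exact: heis_dual_fixedE.
Qed.
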